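(* Let $q$ be a prime with $q\equiv1\pmod4$, and write $q=a^2+b^2$ with $a,b\in\mathbb Z$, $a$ odd. Let $p$ be an odd prime with $p\nmid aq$. Then $$(-1)^{\frac{p-1}2\cdot\frac{q-1}4}\sum_{k=0}^{[p/4]}\binom{4k}{2k}\Big(\frac{b^2}{16q}\Big)^k\equiv\begin{cases}\pm1\pmod p&\text{if }p^{\frac{q-1}4}\equiv\pm1\pmod q,\\ \mp\frac ba\pmod p&\text{if }p^{\frac{q-1}4}\equiv\pm\frac ba\pmod q.\end{cases}$$
   Context: $[x]$ is the greatest integer $\le x$. $\frac ba$ is interpreted modulo $q$ as a residue and modulo $p$ as the rational $b/a$. *)

(* Defs.v *)
From HB Require Import structures.
From mathcomp Require Import all_boot all_order all_algebra.
Set Implicit Arguments. Unset Strict Implicit. Unset Printing Implicit Defensive.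
Import Order.TTheory GRing.Theory Num.Theory.

Definition sunsum (p q : nat) (b : int) : 'F_p :=
  (\sum_(k < (p %/ 4).+1)
     ('C(4 * k, 2 * k))%:R * ((b ^+ 2)%:~R / (16 * q)%:R) ^+ k)%R.

(* Main.v *)
Require Import Defs.
From HB Require Import structures.
From mathcomp Require Import all_boot all_order all_algebra.
From mathcomp Require Import all_solvable all_field.
From mathcomp Require Import ring zify.
Set Implicit Arguments. Unset Strict Implicit. Unset Printing Implicit Defensive.
Import Order.TTheory GRing.Theory Num.Theory.

(* Let n = (p-1)/2.  Since 'C(2m, m) = (-4)^m 'C(n, m) modulo p, the sum is half of
   (1 + b/g)^n + (1 - b/g)^n, where g^2 = q.  Take for g the quadratic Gauss sum over F_q
   in an extension of F_p containing the 4q-th roots of unity, and let G, H be the Gauss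
   sums of the quartic character chi with chi(x) = i when x^((q-1)/4) = b/a, and of its
   inverse.  Then G^2 = J g, H^2 = J' g and G H = chi(-1) q, where the Jacobi sum
   J = A + B i and its conjugate J' = A - B i satisfy A = +-a, B/A = b/a.  Hence
   (G + i H)^2 = 2 i g (B + chi(-1) g), so the n-th powers above are (p-1)-st powers of
   G +- i H, and the Frobenius map evaluates the p-th powers through chi(p). *)

(** * Gauss and Jacobi sums over a finite field with values in an arbitrary field *)

Section GaussSums.
Local Open Scope ring_scope.
Variables (F : finFieldType) (K : fieldType).
Implicit Types chi lam psi : F -> K.

Definition gauss psi chi : K := \sum_x chi x * psi x.

Definition jacobi chi lam : K := \sum_x chi x * lam (1 - x).

(** Serves the orthogonality relations: a change of variable multiplies a character sum by a
    character value other than 1. *)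
Lemma eq0_of_fixed (R : idomainType) (c s : R) : c * s = s -> c != 1 -> s = 0.
Proof.
move=> e c1; have /eqP : (c - 1) * s = 0 by rewrite mulrBl e mul1r subrr.
by rewrite mulf_eq0 subr_eq0 (negPf c1) => /eqP.
Qed.

Lemma sum_mul_char_eq0 chi y :
  {morph chi : x z / x * z} -> y != 0 -> chi y != 1 -> \sum_x chi x = 0.
Proof.
move=> chiM y0; apply: eq0_of_fixed.
rewrite [RHS](reindex_inj (mulfI y0)) mulr_sumr.
by apply: eq_bigr => x _; rewrite chiM.
Qed.

Lemma sum_add_char_eq0 psi c y :
  {morph psi : x z / x + z >-> x * z} -> psi y != 1 -> c != 0 ->
  \sum_x psi (c * x) = 0.
Proof.
move=> psiD psiy c0.
transitivity (\sum_x psi x); first by rewrite [RHS](reindex_inj (mulfI c0)).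
apply: eq0_of_fixed psiy.
rewrite [RHS](reindex_inj (addrI y)) mulr_sumr.
by apply: eq_bigr => x _; rewrite psiD.
Qed.

Section Products.
Variables (psi chi lam : F -> K).
Hypothesis psiD : {morph psi : x z / x + z >-> x * z}.
Hypothesis chiM : {morph chi : x z / x * z}.
Hypothesis lamM : {morph lam : x z / x * z}.
Hypotheses (chi0 : chi 0 = 0) (lam0 : lam 0 = 0).

(** Sort the product by the sum s of the two arguments. For s nonzero, scaling by s makes a Jacobi
    sum appear; for s = 0 the inner sum is [lam (-1)] times the sum assumed to vanish. *)
Lemma gauss_mul :
  \sum_x chi x * lam x = 0 ->
  gauss psi chi * gauss psi lam =
    jacobi chi lam * gauss psi (fun x => chi x * lam x).
Proof.
move=> sum0.
transitivity (\sum_s psi s * \sum_x chi x * lam (s - x)).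
  rewrite big_distrl /=.
  under [RHS]eq_bigr => s _ do rewrite big_distrr /=.
  rewrite exchange_big /=; apply: eq_bigr => x _.
  rewrite big_distrr (reindex_inj (addIr (- x))) /=.
  apply: eq_bigr => s _.
  have -> : psi s = psi (s - x) * psi x by rewrite -psiD subrK.
  ring.
rewrite mulrC big_distrl /=; apply: eq_bigr => s _.
rewrite [RHS]mulrAC [RHS]mulrC; congr (_ * _).
have [->|s0] := eqVneq s 0.
  rewrite chi0 !mul0r.
  under eq_bigr => x _ do rewrite add0r -mulN1r lamM mulrCA.
  by rewrite -mulr_sumr sum0 mulr0.
rewrite (reindex_inj (mulfI s0)) big_distrr /=; apply: eq_bigr => x _.
have -> : s - s * x = s * (1 - x) by ring.
rewrite chiM lamM; ring.
Qed.

Lemma gauss_mul_inv y :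
  psi y != 1 -> psi 0 = 1 ->
  (forall x, x != 0 -> lam x * chi x = 1) -> \sum_x chi x = 0 ->
  gauss psi chi * gauss psi lam = chi (-1) * #|F|%:R.
Proof.
move=> psiy psi0 lamK sum0.
(* The variable of [chi] is written as y t. This is no substitution at y = 0, where [lam] vanishes;
   the subtracted term, zero by [sum0], makes the equality hold for that summand too. Summing over y
   first then leaves only t = -1. *)
transitivity (\sum_y (\sum_t chi t * psi (y * (t + 1)) - (y == 0)%:R * \sum_t chi t)).
  rewrite mulrC big_distrl /=; apply: eq_bigr => z _.
  have [->|z0] := eqVneq z 0.
    rewrite lam0 !mul0r mul1r; under eq_bigr => t _ do rewrite mul0r psi0 mulr1.
    by rewrite subrr.
  rewrite mul0r subr0 big_distrr (reindex_inj (mulfI z0)) /=.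
  apply: eq_bigr => t _.
  rewrite chiM mulrDr mulr1 psiD.
  by rewrite -[RHS]mul1r -(lamK z z0); ring.
rewrite sum0; under eq_bigr => z _ do rewrite mulr0 subr0.
rewrite exchange_big /= (bigD1 (-1)) //= [X in _ + X]big1 ?addr0 => [|t tN1].
  under eq_bigr => z _ do rewrite addNr mulr0 psi0 mulr1.
  by rewrite sumr_const mulr_natr.
rewrite -mulr_sumr.
under eq_bigr => z _ do rewrite mulrC.
by rewrite (sum_add_char_eq0 psiD psiy) ?mulr0 // addr_eq0.
Qed.

End Products.
End GaussSums.

(** * The quartic residue character and its Jacobi sum *)

Section QuarticCharacter.
Local Open Scope ring_scope.
Variables (F : finFieldType) (iota : F) (e : nat).
Implicit Types x y u v : F.
Hypotheses (iota2 : iota ^+ 2 = -1) (N1neq1 : -1 != 1 :> F).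
Hypothesis cardF : #|F| = (4 * e).+1.

(** On 0 and the fourth roots of unity, [qre] and [qim] are the coordinates of the corresponding
    Gaussian integer, with [iota] in the role of i. Integer coordinates let one Jacobi sum be read
    in F, in characteristic p and in characteristic 0. *)
Definition qre (u : F) : int := (u == 1)%:Z - (u == -1)%:Z.
Definition qim (u : F) : int := (u == iota)%:Z - (u == - iota)%:Z.

Lemma qreN u : qre (- u) = - qre u.
Proof. by rewrite /qre opprB eqr_oppLR eqr_opp. Qed.

Lemma qimN u : qim (- u) = - qim u.
Proof. by rewrite /qim opprB eqr_oppLR eqr_opp. Qed.

Let iota0 : iota != 0.
Proof. by rewrite -sqrf_eq0 iota2 oppr_eq0 oner_eq0. Qed.

Let iotaN v u : (iota * u == v) = (u == - (iota * v)).
Proof.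
rewrite -(inj_eq (mulfI iota0)) mulrA -expr2 iota2 mulN1r.
by rewrite -[RHS]eqr_opp !opprK.
Qed.

Lemma qre_iota u : qre (iota * u) = - qim u.
Proof. by rewrite /qre /qim !iotaN mulr1 mulrN1 opprK opprB. Qed.

Lemma qim_iota u : qim (iota * u) = qre u.
Proof. by rewrite /qre /qim !iotaN mulrN -expr2 iota2 !opprK. Qed.

Let iotaN1 : iota != 1.
Proof. by apply: contraNneq N1neq1 => h; rewrite -iota2 h expr1n. Qed.

Let iotaNN1 : - iota != 1.
Proof. by apply: contraNneq N1neq1 => h; rewrite -iota2 -sqrrN h expr1n. Qed.

Lemma qre0 : qre 0 = 0.
Proof. by rewrite /qre !(eq_sym 0) oppr_eq0 oner_eq0. Qed.

Lemma qim0 : qim 0 = 0.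
Proof. by rewrite /qim !(eq_sym 0) oppr_eq0 (negPf iota0). Qed.

Lemma qre1 : qre 1 = 1.
Proof. by rewrite /qre eqxx eq_sym (negPf N1neq1). Qed.

Lemma qim1 : qim 1 = 0.
Proof. by rewrite /qim !(eq_sym 1) (negPf iotaN1) (negPf iotaNN1). Qed.

Definition qval (K : fieldType) (j : K) (u : F) : K :=
  (qre u)%:~R + j * (qim u)%:~R.

Definition qchar (K : fieldType) (j : K) (x : F) : K := qval j (x ^+ e).

Definition quartic_root : seq F := [:: 0; 1; -1; iota; - iota].

Lemma e_gt0 : (0 < e)%N.
Proof. by have := finNzRing_gt1 F; rewrite cardF; lia. Qed.

Lemma expf4e x : x != 0 -> x ^+ (4 * e) = 1.
Proof.
move=> x0; apply: (mulfI x0); rewrite mulr1 -exprS -cardF; exact: expf_card.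
Qed.

Lemma expe_quartic x : x ^+ e \in quartic_root.
Proof.
have [->|x0] := eqVneq x 0; first by rewrite expr0n eqn0Ngt e_gt0 inE eqxx.
have := expf4e x0; rewrite mulnC exprM; move: (x ^+ e) => u u4.
have : (u - 1) * (u + 1) * (u - iota) * (u + iota) = 0.
  transitivity ((u ^+ 2 - 1) * (u ^+ 2 - iota ^+ 2)); first by ring.
  by rewrite iota2; transitivity (u ^+ 4 - 1); [ring | rewrite u4 subrr].
move/eqP; rewrite !mulf_eq0 !subr_eq0 !addr_eq0 !inE -!orbA => ->.
by rewrite orbT.
Qed.

Section Values.
Variables (K : fieldType) (j : K).
Hypothesis j2 : j ^+ 2 = -1.

Lemma qvalN u : qval j (- u) = - qval j u.
Proof. rewrite /qval qreN qimN !mulrNz; ring. Qed.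

Lemma qval_iota u : qval j (iota * u) = j * qval j u.
Proof.
rewrite /qval qre_iota qim_iota mulrNz mulrDr mulrA -expr2 j2; ring.
Qed.

Lemma qval0 : qval j 0 = 0.
Proof. by rewrite /qval qre0 qim0 mulr0 addr0. Qed.

Lemma qval1 : qval j 1 = 1.
Proof. by rewrite /qval qre1 qim1 mulr0 addr0. Qed.

Lemma qvali : qval j iota = j.
Proof. by rewrite -[iota]mulr1 qval_iota qval1 mulr1. Qed.

Lemma qvalM u v : u \in quartic_root -> qval j (u * v) = qval j u * qval j v.
Proof.
rewrite !inE => /or4P[/eqP->|/eqP->|/eqP->|/orP[/eqP->|/eqP->]].
- by rewrite mul0r qval0 mul0r.
- by rewrite mul1r qval1 mul1r.
- by rewrite mulN1r !qvalN qval1 mulN1r.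
- by rewrite qval_iota qvali.
- by rewrite mulNr !qvalN qval_iota qvali mulNr.
Qed.

Lemma qcharM : {morph qchar j : x y / x * y}.
Proof. by move=> x y; rewrite /qchar exprMn qvalM // expe_quartic. Qed.

Lemma qchar0 : qchar j 0 = 0.
Proof. by rewrite /qchar expr0n eqn0Ngt e_gt0 qval0. Qed.

Lemma qcharN1 : qchar j (-1) = (-1) ^+ e.
Proof.
rewrite /qchar -(signr_odd F) -(signr_odd K).
by case: (odd e); rewrite ?expr1 ?expr0 ?qvalN qval1.
Qed.

Lemma qvalK u : u \in quartic_root -> u != 0 -> qval (- j) u * qval j u = 1.
Proof.
have jj : - j * j = 1 by rewrite mulNr -expr2 j2 opprK.
have Nj2 : (- j) ^+ 2 = -1 by rewrite sqrrN.
have Nval v : qval (- j) (- v) = - qval (- j) v.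
  by rewrite /qval qreN qimN !mulrNz; ring.
have v1 : qval (- j) 1 = 1 by rewrite /qval qre1 qim1 mulr0 addr0.
have vi : qval (- j) iota = - j.
  by rewrite /qval -[iota]mulr1 qre_iota qim_iota qre1 qim1; ring.
rewrite !inE => /or4P[/eqP->|/eqP->|/eqP->|/orP[/eqP->|/eqP->]] u0.
- by rewrite eqxx in u0.
- by rewrite qval1 v1 mulr1.
- by rewrite qvalN Nval qval1 v1 mulrNN mulr1.
- by rewrite qvali vi.
- by rewrite qvalN Nval qvali vi mulrNN.
Qed.

Lemma qcharK x : x != 0 -> qchar (- j) x * qchar j x = 1.
Proof. by move=> x0; rewrite qvalK ?expe_quartic ?expf_eq0 ?(negPf x0) ?andbF. Qed.

Lemma qre_qim u : qre u * qim u = 0.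
Proof.
have [->|u1] := eqVneq u 1; first by rewrite qim1 mulr0.
have [->|uN1] := eqVneq u (-1); first by rewrite qimN qim1 mulr0.
by rewrite /qre (negPf u1) (negPf uN1) mul0r.
Qed.

(** One of the two coordinates is always 0, so the cross term, where the sign of [j] matters,
    vanishes. The character and its inverse thus have the same square, the quadratic character. *)
Lemma qcharN_sq x : qchar (- j) x * qchar (- j) x = qchar j x * qchar j x.
Proof.
rewrite /qchar /qval; set r := _%:~R; set s := _%:~R.
have rs : r * s = 0 by rewrite /r /s -intrM qre_qim.
have -> : (r + - j * s) * (r + - j * s) =
          (r + j * s) * (r + j * s) - 4%:R * j * (r * s) by ring.
by rewrite rs mulr0 subr0.
Qed.

(** Coordinates of the Jacobi sum of the quartic character with itself, the product of the two
    values being the value at x (1 - x). *)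
Definition jacobi_re : int := \sum_(x : F) qre ((x * (1 - x)) ^+ e).
Definition jacobi_im : int := \sum_(x : F) qim ((x * (1 - x)) ^+ e).

Lemma jacobi_qchar :
  jacobi (qchar j) (qchar j) = jacobi_re%:~R + j * jacobi_im%:~R.
Proof.
rewrite /jacobi_re /jacobi_im !rmorph_sum /= mulr_sumr -big_split /=.
by apply: eq_bigr => x _; rewrite -qcharM.
Qed.

End Values.

(** With values in F itself and [j] equal to [iota], the quartic character becomes the power map
    with exponent [e]. *)
Lemma qval_id u : u \in quartic_root -> qval iota u = u.
Proof.
rewrite !inE => /or4P[/eqP->|/eqP->|/eqP->|/orP[/eqP->|/eqP->]];
by rewrite ?qvalN ?qval0 ?qval1 ?qvali.
Qed.

Lemma exists_nonroot m :
  (0 < m < 4 * e)%N -> exists2 y : F, y != 0 & y ^+ m != 1.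
Proof.
case/andP=> m0 m4; apply/exists_inP; apply: contraLR m4.
rewrite negb_exists_in -leqNgt => /forall_inP h.
have -> : (4 * e)%N = size (enum (predC1 (0 : F))) by rewrite -cardE cardC1 cardF.
apply: (max_unity_roots m0) (enum_uniq _).
apply/allP=> y; rewrite mem_enum inE => /h; rewrite negbK.
by rewrite unity_rootE.
Qed.

Lemma sum_expr_eq0 m : (0 < m < 4 * e)%N -> \sum_(x : F) x ^+ m = 0.
Proof.
move=> /exists_nonroot[y y0 ym].
by apply: sum_mul_char_eq0 y0 ym => x z; rewrite exprMn.
Qed.

(* [x (1 - x)] raised to the power [e] has degree [2e < q - 1] in [x], so its power
   sum over the field vanishes: the Jacobi sum lies in the prime over [q] that
   identifies [i] with [iota]. *)
Lemma jacobi_iota : (jacobi_re%:~R + iota * jacobi_im%:~R : F) = 0.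
Proof.
rewrite -jacobi_qchar // /jacobi; under eq_bigr => x _.
  rewrite -qcharM // /qchar qval_id ?expe_quartic // exprMn exprDn big_distrr /=.
  over.
rewrite exchange_big /= big1 // => k _.
under eq_bigr => x _.
  rewrite expr1n mul1r -mulN1r exprMn -mulrnAl mulrCA -exprD; over.
by rewrite -mulr_sumr sum_expr_eq0 ?mulr0 //; case: k => k /=; have := e_gt0; lia.
Qed.

(** Some y has y ^ (2e) different from 1, which excludes y ^ e = 1 and y ^ e = -1. Such a y shows
    that the quartic character and its square are nontrivial. *)
Lemma exists_quartic_nonresidue : exists2 y : F, y != 0 &
  y ^+ e = iota \/ y ^+ e = - iota.
Proof.
have [|y y0 ye] := @exists_nonroot (2 * e); first by have := e_gt0; lia.
exists y => //; have := expe_quartic y.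
rewrite mulnC exprM in ye.
rewrite !inE expf_eq0 (negPf y0) andbF /=.
case/or4P=> /eqP h; [| |by left|by right].
  by rewrite h expr1n eqxx in ye.
by rewrite h sqrrN expr1n eqxx in ye.
Qed.

(** * Relations between the quartic and quadratic Gauss sums *)

Section GaussRelations.
Variables (K : fieldType) (j : K) (psi : F -> K) (y : F).
Hypotheses (j2 : j ^+ 2 = -1) (K2 : 2%:R != 0 :> K).
Hypothesis psiD : {morph psi : x z / x + z >-> x * z}.
Hypotheses (psi0 : psi 0 = 1) (psiy : psi y != 1).

Let jN1 : j != 1.
Proof.
apply: contraNneq K2 => h; have := j2; rewrite h expr1n => /eqP.
by rewrite -subr_eq0 opprK.
Qed.

Let jNN1 : - j != 1.
Proof.
apply: contraNneq K2 => h; have := j2; rewrite -sqrrN h expr1n => /eqP.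
by rewrite -subr_eq0 opprK.
Qed.

Lemma sum_qchar : \sum_x qchar j x = 0.
Proof.
have [z z0 ze] := exists_quartic_nonresidue.
apply: sum_mul_char_eq0 z0 _; first exact: qcharM.
by rewrite /qchar; case: ze => ->; rewrite ?qvalN qvali.
Qed.

Definition qchar2 (x : F) : K := qchar j x * qchar j x.

Lemma qchar2M : {morph qchar2 : x z / x * z}.
Proof. by move=> x z; rewrite /qchar2 qcharM //; ring. Qed.

Lemma sum_qchar2 : \sum_x qchar2 x = 0.
Proof.
have [z z0 ze] := exists_quartic_nonresidue.
apply: sum_mul_char_eq0 z0 _; first exact: qchar2M.
have N1K : -1 != 1 :> K by rewrite eq_sym -subr_eq0 opprK.
by rewrite /qchar2 /qchar; case: ze => ->; rewrite ?qvalN qvali // ?mulrNN -expr2 j2.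
Qed.

Lemma qchar2K x : x != 0 -> qchar2 x * qchar2 x = 1.
Proof.
move=> x0; rewrite {1}/qchar2 -qcharN_sq // /qchar2 mulrACA.
by rewrite qcharK // mulr1.
Qed.

Lemma gauss_qchar_sq :
  gauss psi (qchar j) ^+ 2 =
    (jacobi_re%:~R + j * jacobi_im%:~R) * gauss psi qchar2.
Proof.
rewrite expr2 gauss_mul ?jacobi_qchar //;
  by [exact: qcharM | exact: qchar0 | exact: sum_qchar2].
Qed.

Lemma gauss_qchar_conj :
  gauss psi (qchar j) * gauss psi (qchar (- j)) = (-1) ^+ e * #|F|%:R.
Proof.
rewrite (gauss_mul_inv psiD _ _ psiy psi0) ?qcharN1 //;
  by [exact: qcharM | exact: qchar0 | exact: qcharK | exact: sum_qchar].
Qed.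

Lemma gauss_qchar2_sq : gauss psi qchar2 ^+ 2 = #|F|%:R.
Proof.
rewrite expr2 (gauss_mul_inv psiD _ _ psiy psi0) //.
- by rewrite /qchar2 qcharN1 // -exprMn mulrNN mulr1 expr1n mul1r.
- exact: qchar2M.
- by rewrite /qchar2 qchar0 ?mul0r.
- exact: qchar2K.
- exact: sum_qchar2.
Qed.

End GaussRelations.

Lemma qchar2_conj (K : fieldType) (j : K) : j ^+ 2 = -1 ->
  qchar2 (- j) =1 qchar2 j.
Proof. by move=> j2 x; rewrite /qchar2 qcharN_sq. Qed.

Lemma gauss_qcharN_sq (K : fieldType) (j : K) (psi : F -> K) :
  j ^+ 2 = -1 -> 2%:R != 0 :> K -> {morph psi : x z / x + z >-> x * z} ->
  gauss psi (qchar (- j)) ^+ 2 =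
    (jacobi_re%:~R - j * jacobi_im%:~R) * gauss psi (qchar2 j).
Proof.
move=> j2 K2 psiD; rewrite gauss_qchar_sq ?sqrrN // mulNr; congr (_ * _).
by apply: eq_bigr => x _; rewrite qchar2_conj.
Qed.

(** Square the relation G H = chi(-1) q, insert the formulas for the squares of G and H, and cancel
    the square of the quadratic Gauss sum, which is q. *)
Lemma jacobi_norm (K : fieldType) (j : K) (psi : F -> K) (y : F) :
  j ^+ 2 = -1 -> 2%:R != 0 :> K -> #|F|%:R != 0 :> K ->
  {morph psi : x z / x + z >-> x * z} -> psi 0 = 1 -> psi y != 1 ->
  (jacobi_re ^+ 2 + jacobi_im ^+ 2)%:~R = #|F|%:R :> K.
Proof.
move=> j2 K2 q0 psiD psi0 psiy; apply: (mulIf q0).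
rewrite -{1}(gauss_qchar2_sq j2 K2 psiD psi0 psiy).
have /(congr1 (fun z : K => z ^+ 2)) := gauss_qchar_conj j2 K2 psiD psi0 psiy.
rewrite exprMn gauss_qchar_sq // gauss_qcharN_sq // [RHS]exprMn sqrr_sign mul1r -expr2 => <-.
rewrite intrD !rmorphXn /=.
set A := _%:~R; set B := _%:~R; set G := gauss _ _.
have -> : A ^+ 2 + B ^+ 2 = (A ^+ 2 - (-1) * B ^+ 2) by ring.
by rewrite -j2; ring.
Qed.

Let two_neq0 : 2%:R != 0 :> F.
Proof. by rewrite mulr2n addr_eq0 eq_sym. Qed.

(** The involution x -> 1 - x has 1/2 as its only fixed point. The witness sums [h] over the member
    of smaller rank in each remaining pair. *)
Lemma even_sum_reflection (h : F -> int) :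
  (forall x, h (1 - x) = h x) -> h 2%:R^-1 = 0 ->
  exists m, \sum_x h x = m + m.
Proof.
move=> hsym h0; pose s (x : F) := 1 - x.
have sK : involutive s by move=> x; rewrite /s opprB addrCA subrr addr0.
pose r (x : F) := nat_of_ord (enum_rank x).
have r_inj x z : r x = r z -> x = z by move/val_inj/enum_rank_inj.
exists (\sum_(x | (r x < r (s x))%N) h x).
rewrite (bigID (fun x => r x < r (s x))%N) /=; congr (_ + _).
rewrite (bigID (fun x => r (s x) < r x)%N) /= [X in _ + X]big1 ?addr0.
  rewrite (reindex_inj (inv_inj sK)) /=; apply: eq_big => x; rewrite ?sK //.
    by apply/andP/idP => [[]//|]; case: ltngtP.
  by rewrite hsym.
move=> x; case: ltngtP => // /r_inj xs _.
rewrite (_ : x = 2%:R^-1) // -[RHS]mul1r; apply: (canRL (mulfK two_neq0)).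
by rewrite mulr_natr mulr2n [X in X + _]xs subrK.
Qed.

(** At the fixed point 1/2 the argument x (1 - x) is a square, so its power is the square of a
    fourth root of unity, hence 1 or -1, and has no imaginary part. *)
Lemma jacobi_im_even : exists m, jacobi_im = m + m.
Proof.
apply: even_sum_reflection => [x|].
  by rewrite opprB addrCA subrr addr0 mulrC.
have -> : 2%:R^-1 * (1 - 2%:R^-1) = 2%:R^-1 ^+ 2 :> F by field.
rewrite -exprM mulnC exprM.
have := expe_quartic 2%:R^-1; rewrite !inE.
case/or4P=> [/eqP->|/eqP->|/eqP->|/orP[]/eqP->];
  by rewrite ?sqrrN ?expr0n ?expr1n ?iota2 ?qimN ?qim0 ?qim1 ?oppr0.
Qed.

End QuarticCharacter.

(** * Central binomial coefficients modulo p and sums over even indices *)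

Section BinomialSums.
Local Open Scope ring_scope.

Lemma mul_succ_central_binomial m :
  (m.+1 * 'C(2 * m.+1, m.+1) = 2 * (2 * m).+1 * 'C(2 * m, m))%N.
Proof.
have h1 := mul_bin_diag (2 * m.+1) m.
have h2 := mul_bin_down (2 * m).+1 m.
have h3 := mul_bin_diag (2 * m).+1 m.
rewrite (_ : (2 * m.+1).-1 = (2 * m).+1) in h1; last by lia.
rewrite (_ : ((2 * m).+1 - m = m.+1)%N) /= in h2; last by lia.
move: h1 h2; set x := 'C(_, _); set y := 'C(_, _); set z := 'C(_, _); nia.
Qed.

(* Both sides are [(-4) ^ m] times a binomial coefficient: of [-1/2] on the left, and
   of [n], which equals [-1/2] modulo [2n+1], on the right. *)
Lemma central_binomial_pchar (K : fieldType) (n m : nat) :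
  (2 * n).+1 \in [pchar K] -> (m <= n)%N ->
  ('C(2 * m, m))%:R = (- 4%:R) ^+ m * ('C(n, m))%:R :> K.
Proof.
move=> pK; elim: m => [|m IH] mn; first by rewrite !bin0 expr0 mulr1.
have m1 : m.+1%:R != 0 :> K.
  by rewrite -(dvdn_pcharf pK) gtnNdvd //; lia.
apply: (mulfI m1); rewrite -natrM mul_succ_central_binomial natrM IH ?(ltnW mn) //.
rewrite [RHS]mulrCA -[in RHS]natrM mul_bin_left [((n - m) * _)%:R]natrM.
rewrite natrB ?(ltnW mn) // exprS.
have p0 : 2%:R * n%:R + 1 = 0 :> K by rewrite -natrM natr1 (pcharf0 pK).
have -> : (2 * (2 * m).+1)%:R = 2%:R * (2%:R * m%:R + 1) :> K.
  by rewrite natrM -[(2 * m).+1%:R]natr1 natrM.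
move: (_ ^+ m) ('C(n, m))%:R => P C; apply/eqP; rewrite -subr_eq0; apply/eqP.
by transitivity (2%:R * P * C * (2%:R * n%:R + 1)); [ring | rewrite p0 mulr0].
Qed.

Lemma sum_even_odd (R : nmodType) (f : nat -> R) M :
  \sum_(i < 2 * M) f i = \sum_(k < M) (f (2 * k)%N + f (2 * k).+1).
Proof.
elim: M => [|M IH]; first by rewrite muln0 !big_ord0.
rewrite [RHS]big_ord_recr /= -IH addrA (_ : 2 * M.+1 = (2 * M).+2)%N; last by lia.
by rewrite !big_ord_recr.
Qed.

Lemma sum_even_binomial (R : comNzRingType) (n : nat) (t : R) :
  (1 + t) ^+ n + (1 - t) ^+ n =
  2%:R * \sum_(k < (n %/ 2).+1) ('C(n, 2 * k))%:R * (t ^+ 2) ^+ k.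
Proof.
pose f (u : R) i := u ^+ i *+ 'C(n, i).
have expand u : (1 + u) ^+ n = \sum_(i < 2 * (n %/ 2).+1) f u i.
  (* The range is padded to even length so that indices pair up; for even n this adds the index n +
     1, whose binomial coefficient is 0. *)
  rewrite exprDn; have le : (n.+1 <= 2 * (n %/ 2).+1)%N by lia.
  rewrite (big_ord_widen_cond _ predT (fun i => 1 ^+ (n - i) * u ^+ i *+ 'C(n, i)) le) /=.
  rewrite big_mkcond /=; apply: eq_bigr => i _.
  by rewrite expr1n mul1r ltnS; case: leqP => // h; rewrite /f bin_small ?mulr0n.
rewrite !expand -big_split /= (sum_even_odd (fun i => f t i + f (- t) i)) mulr_sumr.
apply: eq_bigr => k _; rewrite /f.
rewrite exprS (exprS (- t)) !exprM sqrrN mulNr mulNrn subrr addr0.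
by rewrite -mulr_natl; ring.
Qed.

End BinomialSums.

(** * The Frobenius map on Gauss sums *)

Section FrobeniusGauss.
Local Open Scope ring_scope.
Variables (F : finFieldType) (iota : F) (e : nat).
Hypotheses (iota2 : iota ^+ 2 = -1) (N1neq1 : -1 != 1 :> F).
Hypothesis cardF : #|F| = (4 * e).+1.
Variables (K : fieldType) (p : nat) (psi : F -> K).
Hypotheses (pK : p \in [pchar K]) (p0 : p%:R != 0 :> F).
Hypothesis psiD : {morph psi : x z / x + z >-> x * z}.
Hypothesis psi0 : psi 0 = 1.

Lemma add_char_exp x : psi x ^+ p = psi (p%:R * x).
Proof.
rewrite mulr_natl; elim: p => [|m IH]; first by rewrite mulr0n psi0.
by rewrite exprS mulrS psiD IH.
Qed.

(** In characteristic p the p-th power acts termwise and turns [psi x] into [psi (p x)]; replacing p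
    x by x costs the inverse of [chi' p]. *)
Lemma gauss_frobenius (chi chi' lam : F -> K) :
  (forall x, chi x ^+ p = chi' x) -> {morph chi' : x z / x * z} ->
  (forall x, x != 0 -> lam x * chi' x = 1) ->
  gauss psi chi ^+ p = lam p%:R * gauss psi chi'.
Proof.
move=> chiE chiM lamK; rewrite /gauss -(pFrobenius_autE pK) rmorph_sum /=.
rewrite [X in _ * X](reindex_inj (mulfI p0)) mulr_sumr; apply: eq_bigr => x _.
rewrite pFrobenius_autE exprMn chiE add_char_exp chiM !mulrA.
by rewrite lamK // mul1r.
Qed.

Variable j : K.
Hypotheses (j2 : j ^+ 2 = -1).

Lemma qchar_frobenius (j' : K) x : qchar iota e j' x ^+ p = qchar iota e (j' ^+ p) x.
Proof.
by rewrite /qchar /qval -(pFrobenius_autE pK) rmorphD rmorphM !rmorph_int.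
Qed.

Lemma gauss_qchar_frobenius (j' : K) : j' ^+ p = j \/ j' ^+ p = - j ->
  gauss psi (qchar iota e j') ^+ p =
  qchar iota e (- (j' ^+ p)) p%:R * gauss psi (qchar iota e (j' ^+ p)).
Proof.
move=> jp; have jp2 : (j' ^+ p) ^+ 2 = -1 by case: jp => ->; rewrite ?sqrrN.
apply: gauss_frobenius; first by move=> x; rewrite qchar_frobenius.
  exact: qcharM.
by move=> x; exact: qcharK.
Qed.

Lemma gauss_qchar2_frobenius : j ^+ p = j \/ j ^+ p = - j ->
  gauss psi (qchar2 iota e j) ^+ p =
  qchar iota e j p%:R ^+ 2 * gauss psi (qchar2 iota e j).
Proof.
move=> jp; rewrite expr2 -/(qchar2 iota e j _); apply: gauss_frobenius.
- move=> x; rewrite /qchar2 exprMn qchar_frobenius.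
  by case: jp => -> //; rewrite qcharN_sq.
- exact: qchar2M.
- exact: qchar2K.
Qed.

End FrobeniusGauss.

(** * The algebraic identity extracted from the Gauss sum relations *)

Section KeyIdentity.
Local Open Scope ring_scope.

(** Here G, H are the quartic Gauss sums, g the quadratic one, a + j b the Jacobi sum, c = chi(-1),
    Q = q, X = chi(p) and Y is the inverse of X. Only their algebraic relations are kept. *)
Lemma power_sum_of_gauss_relations (K : fieldType) (n : nat)
    (j a b c Q G H g X Y : K) :
  (2 * n).+1 \in [pchar K] -> j ^+ 2 = -1 -> c ^+ 2 = 1 -> 2%:R != 0 :> K ->
  Q != 0 ->
  G ^+ 2 = (a + j * b) * g -> H ^+ 2 = (a - j * b) * g -> G * H = c * Q ->
  g ^+ 2 = Q -> g ^+ (2 * n).+1 = X ^+ 2 * g ->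
  (j ^+ (2 * n).+1 = j ->
     G ^+ (2 * n).+1 = Y * G /\ H ^+ (2 * n).+1 = X * H) ->
  (j ^+ (2 * n).+1 = - j ->
     G ^+ (2 * n).+1 = X * H /\ H ^+ (2 * n).+1 = Y * G) ->
  c ^+ n * ((1 + b / g) ^+ n + (1 - b / g) ^+ n) * (X ^+ 2 * a) =
  Y * (a + j * b) + X * (a - j * b).
Proof.
move=> pK j2 c2 K2 Q0 G2 H2 GH g2 gp jp1 jpN.
have g0 : g != 0 by rewrite -sqrf_eq0 g2.
set t := b / g; have bE : b = t * g by rewrite /t divfK.
pose W := G + j * H; pose V := G - j * H.
(* The factor 2 j is written as (1 + j)^2, so that its n-th power is a (p-1)-st power of 1 + j,
   which Frobenius evaluates after one more factor. *)
have W2 : W ^+ 2 = (1 + j) ^+ 2 * c * Q * (1 + c * t).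
  have -> : W ^+ 2 = G ^+ 2 + j ^+ 2 * H ^+ 2 + 2%:R * j * (G * H) by rewrite /W; ring.
  rewrite G2 H2 GH sqrrD expr1n j2 -g2 {1 2}bE.
  by transitivity (2%:R * j * g ^+ 2 * (t * c ^+ 2 + c)); [rewrite c2; ring | ring].
have V2 : V ^+ 2 = - ((1 + j) ^+ 2 * c * Q * (1 - c * t)).
  have -> : V ^+ 2 = G ^+ 2 + j ^+ 2 * H ^+ 2 - 2%:R * j * (G * H) by rewrite /V; ring.
  rewrite G2 H2 GH sqrrD expr1n j2 -g2 {1 2}bE.
  by transitivity (2%:R * j * g ^+ 2 * (t * c ^+ 2 - c)); [rewrite c2; ring | ring].
have WV : W * V = 2%:R * a * g.
  have -> : W * V = G ^+ 2 - j ^+ 2 * H ^+ 2 by rewrite /W /V; ring.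
  by rewrite G2 H2 j2; ring.
(* Quadratic reciprocity in disguise: q^((p-1)/2) is the quadratic character of p. *)
have Qn : Q ^+ n = X ^+ 2 by apply: (mulIf g0); rewrite -gp -g2 -exprM -exprSr.
have jp : j ^+ (2 * n).+1 = (-1) ^+ n * j by rewrite exprSr exprM j2.
have jfrob : (1 + j) ^+ (2 * n).+1 = 1 + (-1) ^+ n * j.
  by rewrite -(pFrobenius_autE pK) rmorphD rmorph1 /= pFrobenius_autE jp.
have frobW : W ^+ (2 * n).+1 = G ^+ (2 * n).+1 + (-1) ^+ n * j * H ^+ (2 * n).+1.
  by rewrite -!(pFrobenius_autE pK) rmorphD rmorphM /= !pFrobenius_autE jp.
have frobV : V ^+ (2 * n).+1 = G ^+ (2 * n).+1 - (-1) ^+ n * j * H ^+ (2 * n).+1.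
  by rewrite -!(pFrobenius_autE pK) rmorphB rmorphM /= !pFrobenius_autE jp.
(* As c is 1 or -1, it at most exchanges the two powers. *)
have cE : (1 + t) ^+ n + (1 - t) ^+ n = (1 + c * t) ^+ n + (1 - c * t) ^+ n.
  have /eqP : (c - 1) * (c + 1) = 0 by rewrite -subr_sqr c2 expr1n subrr.
  rewrite mulf_eq0 subr_eq0 addr_eq0 => /orP[]/eqP->; first by rewrite mul1r.
  by rewrite mulN1r opprK addrC.
(* The factor 2 a g equals W V and supplies the missing W or V, raising each (p-1)-st power to a
   p-th power; the last factor is (1 + j)^p. *)
have main : c ^+ n * ((1 + t) ^+ n + (1 - t) ^+ n) * (X ^+ 2 * a) *
    (2%:R * g * (1 + (-1) ^+ n * j)) =
    (1 + j) * (W ^+ (2 * n).+1 * V + (-1) ^+ n * (V ^+ (2 * n).+1 * W)).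
  rewrite cE -jfrob (exprS W) (exprS V) (exprS (1 + j)) !exprM W2 V2 -Qn.
  rewrite (exprNn ((1 + j) ^+ 2 * c * Q * (1 - c * t))) !exprMn.
  have s2 : (-1) ^+ n * (-1) ^+ n = 1 :> K by rewrite -exprMn mulrNN mulr1 expr1n.
  set s := (-1) ^+ n; set d := (1 + j) ^+ n.
  move: (c ^+ n) (Q ^+ n) => cn qn.
  set u := (1 + c * t) ^+ n; set v := (1 - c * t) ^+ n.
  transitivity ((1 + j) * d ^+ 2 * cn * qn * (W * V) * (u + (s * s) * v)).
    by rewrite WV s2; ring.
  by ring.
have jj : (1 - j) * (1 + j) = 2%:R by rewrite -subr_sqr j2 expr1n opprK.
have j1 : 1 + j != 0 by apply: contraNneq K2 => h; rewrite -jj h mulr0.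
have Nj1 : 1 - j != 0 by apply: contraNneq K2 => h; rewrite -jj h mul0r.
(* The parity of n is the class of p modulo 4: for odd n Frobenius sends j to -j and exchanges G and
   H up to factors. *)
move: main jp jp1 jpN; rewrite frobW frobV -[in (-1) ^+ n]signr_odd.
case: (odd n) => /= [|]; rewrite ?expr1 ?expr0 ?mulN1r ?mul1r => main jp jp1 jpN.
- have [Gp Hp] := jpN jp; rewrite {}Gp {}Hp in main.
  have nz : 2%:R * g * (1 - j) != 0 by rewrite !mulf_neq0.
  apply: (mulIf nz); rewrite main.
  transitivity ((1 + j) * (-2%:R * j) * (X * H ^+ 2 + Y * G ^+ 2)).
    by rewrite /W /V; ring.
  rewrite G2 H2.
  transitivity (2%:R * (- j - j ^+ 2) * g * (Y * (a + j * b) + X * (a - j * b))).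
    by ring.
  by rewrite j2; ring.
- have [Gp Hp] := jp1 jp; rewrite {}Gp {}Hp in main.
  have nz : 2%:R * g * (1 + j) != 0 by rewrite !mulf_neq0.
  apply: (mulIf nz); rewrite main.
  transitivity ((1 + j) * 2%:R * (Y * G ^+ 2 - j ^+ 2 * X * H ^+ 2)).
    by rewrite /W /V; ring.
  by rewrite G2 H2 j2; ring.
Qed.

End KeyIdentity.

(** * The additive character of the prime field given by a primitive root of unity *)

Section AdditiveCharacter.
Local Open Scope ring_scope.
Variables (q : nat) (K : fieldType) (z : K).
Hypotheses (q_pr : prime q) (zq : q.-primitive_root z).

Definition add_char (x : 'F_q) : K := z ^+ x.

Lemma add_charD : {morph add_char : x y / x + y >-> x * y}.
Proof.
move=> x y; rewrite /add_char -exprD -[RHS](prim_expr_mod zq) /=.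
by congr (z ^+ (_ %% _)%N); exact: Fp_cast.
Qed.

Lemma add_char1 : add_char 1 != 1.
Proof.
rewrite /add_char (_ : nat_of_ord _ = 1%N); last exact: modn_small.
rewrite expr1 -[z]expr1 -(prim_order_dvd zq) dvdn1 neq_ltn.
by rewrite prime_gt1 ?orbT.
Qed.

End AdditiveCharacter.

(** * Parity facts about integers *)

Section Parity.
Local Open Scope ring_scope.
Implicit Types k l m n : int.

Lemma odd_absz_sq n : odd (absz (n ^+ 2)) = odd (absz n).
Proof. by rewrite abszX oddX. Qed.

Lemma even_int_half n : ~~ odd (absz n) -> exists k, n = k + k.
Proof. by exists (n %/ 2)%Z; lia. Qed.

Lemma odd_absz_sub_sq (e : nat) n :
  odd (absz n) -> ~~ odd (absz ((4 * e).+1%:Z - n ^+ 2)).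
Proof. by rewrite -odd_absz_sq; move: (n ^+ 2) => s; lia. Qed.

Lemma even_of_even_mul m k l (e : nat) :
  m + m - (k + k) = l * (4 * e).+1%:Z -> ~~ odd (absz l).
Proof.
have -> : l * (4 * e).+1%:Z = 4 * (l * e%:Z) + l by rewrite -addn1 PoszD PoszM; ring.
by move: (l * e%:Z) => t; lia.
Qed.

Lemma even_sq_le1 l : ~~ odd (absz l) -> l ^+ 2 <= 1 -> l = 0.
Proof.
move=> l_even l1; have : `|l| <= 1.
  by rewrite -(@ler_pXn2r _ 2) ?nnegrE // real_normK ?expr1n ?num_real.
by move=> {l1}; lia.
Qed.

End Parity.

(** * Comparing the Jacobi sum with the given representation of q as a sum of two squares *)

Section JacobiRepresentation.
Local Open Scope ring_scope.
Variables (q e : nat) (a b : int).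
Hypotheses (q_pr : prime q) (qE : q = (4 * e).+1).

Let qF : q \in [pchar 'F_q]. Proof. exact: pchar_Fp. Qed.

Let e0 : (0 < e)%N.
Proof. by have := prime_gt1 q_pr; rewrite qE; lia. Qed.

Lemma cardFq : #|'F_q| = (4 * e).+1. Proof. by rewrite card_Fp. Qed.

Lemma FqN1 : -1 != 1 :> 'F_q.
Proof.
rewrite eq_sym -subr_eq0 opprK -[1 + 1]/(2%:R) -(dvdn_pcharf qF) gtnNdvd //; lia.
Qed.

Hypotheses (qab : Posz q = a ^+ 2 + b ^+ 2) (a_odd : odd (absz a)).

Definition sqrtN1 : 'F_q := b%:~R / a%:~R.

Lemma intq0 (n : int) : (n%:~R == 0 :> 'F_q) = (q %| n)%Z.
Proof. by rewrite -(dvdz_pcharf qF). Qed.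

(** If q divided a, it would divide b as well, and its square would divide q. *)
Lemma aF : a%:~R != 0 :> 'F_q.
Proof.
rewrite intq0; apply/negP => /dvdzP[m am].
have b2 : b ^+ 2 = q%:Z - a ^+ 2 by rewrite qab addrAC subrr add0r.
have qb : (q %| b)%Z.
  suff : (q %| b ^+ 2)%Z by rewrite !dvdzE abszX Euclid_dvdX // => /andP[].
  by rewrite b2 am; apply/dvdzP; exists (1 - m ^+ 2 * q%:Z); ring.
have /dvdzP[l bl] := qb.
have : 1 = q%:Z * (m ^+ 2 + l ^+ 2).
  have q0 : q%:Z != 0 by rewrite eqz_nat -lt0n prime_gt0.
  by apply: (mulfI q0); rewrite mulr1 {1}qab am bl; ring.
move=> h; have : (q%:Z %| 1)%Z by apply/dvdzP; exists (m ^+ 2 + l ^+ 2); rewrite mulrC.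
by rewrite dvdz1 absz_nat => /eqP q1; have := prime_gt1 q_pr; rewrite q1.
Qed.

Lemma sqrtN1_sq : sqrtN1 ^+ 2 = -1.
Proof.
rewrite /sqrtN1 expr_div_n; apply: (canLR (mulfK _)); first by rewrite expf_neq0 ?aF.
apply/eqP; rewrite mulN1r -addr_eq0 -!rmorphXn -rmorphD /= addrC -qab.
by rewrite intq0 dvdzz.
Qed.

Notation A := (jacobi_re 'F_q e).
Notation B := (jacobi_im sqrtN1 e).

(** The norm relation is applied over the algebraic numbers, where characteristic 0 turns it into an
    equality of integers. *)
Lemma jacobi_norm_int : A ^+ 2 + B ^+ 2 = q%:Z.
Proof.
have [z zq] := C_prim_root_exists (prime_gt0 q_pr).
have h : (#|'F_q|%:R : algC) != 0 by rewrite pnatr_eq0 card_Fp // -lt0n prime_gt0.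
have two0 : 2%:R != 0 :> algC by rewrite pnatr_eq0.
have := jacobi_norm sqrtN1_sq FqN1 cardFq (sqrCi _) two0 h
  (add_charD q_pr zq) (expr0 _) (add_char1 q_pr zq).
by rewrite card_Fp // => /eqP; rewrite -[q%:R]/(q%:Z%:~R) eqr_int => /eqP.
Qed.

(* [a B - b A] is even and divisible by [q], while its square is at most [q ^ 2]. *)
Lemma jacobi_proportional : a * B = b * A.
Proof.
have AB := jacobi_iota sqrtN1_sq FqN1 cardFq.
have [m Bm] := jacobi_im_even sqrtN1_sq FqN1 cardFq.
have /dvdzP[l hl] : (q %| a * B - b * A)%Z.
  rewrite -intq0 rmorphB !rmorphM /=.
  have -> : b%:~R = a%:~R * sqrtN1 by rewrite /sqrtN1 mulrC divfK ?aF.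
  set x := B%:~R; set y := A%:~R.
  have -> : a%:~R * x - a%:~R * sqrtN1 * y =
    - (a%:~R * sqrtN1) * (y + sqrtN1 * x) + a%:~R * x * (1 + sqrtN1 ^+ 2) by ring.
  by rewrite AB sqrtN1_sq subrr !mulr0 addr0.
(* Brahmagupta's identity for the product of two sums of two squares. *)
have sq : (a * B - b * A) ^+ 2 + (a * A + b * B) ^+ 2 = q%:Z ^+ 2.
  by rewrite [RHS]expr2 {1}qab -jacobi_norm_int; ring.
have [k bk] : exists k, b = k + k.
  apply: even_int_half; rewrite -odd_absz_sq.
  have -> : b ^+ 2 = (4 * e).+1%:Z - a ^+ 2 by rewrite -qE qab addrAC subrr add0r.
  exact: odd_absz_sub_sq.
have l_even : ~~ odd (absz l).
  by apply: (@even_of_even_mul (a * m) (k * A) _ e); rewrite -qE -hl Bm bk; ring.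
have l1 : l ^+ 2 <= 1.
  have q2 : 0 < q%:Z ^+ 2 by rewrite exprn_gt0 // ltz_nat prime_gt0.
  by rewrite -(ler_pM2r q2) mul1r -exprMn -hl -sq lerDl sqr_ge0.
have l0 := even_sq_le1 l_even l1.
by apply/eqP; rewrite -subr_eq0 hl l0 mul0r.
Qed.

Lemma jacobi_re_sq : A ^+ 2 = a ^+ 2.
Proof.
have q0 : q%:Z != 0 by rewrite eqz_nat -lt0n prime_gt0.
apply: (mulIf q0); rewrite {1}qab -jacobi_norm_int.
have -> : A ^+ 2 * (a ^+ 2 + b ^+ 2) = A ^+ 2 * a ^+ 2 + (b * A) ^+ 2 by ring.
by rewrite -jacobi_proportional; ring.
Qed.

End JacobiRepresentation.

(** Since p does not divide m, X^m - 1 is separable, so its splitting field contains m distinct m-th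
    roots of unity, among them a primitive one. *)
Lemma exists_prim_root_pchar (p m : nat) :
  prime p -> ~~ (p %| m) -> 0 < m ->
  exists (L : fieldExtType 'F_p) (z : L), (m.-primitive_root z)%R.
Proof.
move=> p_pr pm m0.
have nz : ('X^m - 1 != 0 :> {poly 'F_p})%R by rewrite monic_neq0 ?monicXnsubC.
have [L [rs Drs _]] := FinSplittingFieldFor nz; exists L.
rewrite rmorphB rmorph1 rmorphXn /= map_polyX in Drs.
have pL : p \in [pchar L]%R by rewrite pchar_lalg pchar_Fp.
suff : has (m.-primitive_root)%R rs by case/hasP=> z _ zm; exists z.
apply: has_prim_root => //.
- apply/allP=> z; rewrite -root_prod_XsubC -(eqp_root Drs).
  by rewrite unity_rootE /root !hornerE subr_eq0.
- rewrite -separable_prod_XsubC -(eqp_separable Drs).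
  by rewrite separable_Xn_sub_1 // -(dvdn_pcharf pL).
- rewrite -ltnS -(size_prod_XsubC rs id) -(eqp_size Drs).
  by rewrite size_polyDl size_polyXn // size_polyN size_polyC oner_eq0.
Qed.

(** * Evaluation of the sum in characteristic p *)

Section CharacteristicP.
Local Open Scope ring_scope.
Variables (q e p n : nat) (a b : int).
Hypotheses (q_pr : prime q) (qE : q = (4 * e).+1).
Hypotheses (qab : Posz q = a ^+ 2 + b ^+ 2) (a_odd : odd (absz a)).
Hypotheses (p_pr : prime p) (pE : p = (2 * n).+1).
Hypotheses (pa : ~~ (p%:Z %| a)%Z) (pq : ~~ (p %| q)%N).
Variables (K : fieldExtType 'F_p) (z : K).
Hypothesis zq : (4 * q).-primitive_root z.

Let pF : p \in [pchar 'F_p]. Proof. exact: pchar_Fp. Qed.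
Let pK : p \in [pchar K]. Proof. by rewrite pchar_lalg. Qed.

Let n0 : (0 < n)%N. Proof. by have := prime_gt1 p_pr; rewrite pE; lia. Qed.

Let two_neq0 : 2%:R != 0 :> K.
Proof. by rewrite -(dvdn_pcharf pK) gtnNdvd // pE; lia. Qed.

(** The central binomial coefficient of index 2k brings the factor (-4)^(2k) = 16^k, which cancels
    the 16 in the denominator. *)
Lemma in_alg_sunsum :
  in_alg K (sunsum p q b) =
  \sum_(k < (n %/ 2).+1) ('C(n, 2 * k))%:R * (b%:~R ^+ 2 / q%:R) ^+ k.
Proof.
rewrite /sunsum rmorph_sum /=.
have -> : (p %/ 4 = n %/ 2)%N by rewrite pE; lia.
apply: eq_bigr => k _.
rewrite -[_%:A]/(in_alg K _) rmorphM rmorphXn fmorph_div rmorph_nat rmorph_nat rmorph_int.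
have kn : (2 * k <= n)%N by have := ltn_ord k; lia.
have pK' : (2 * n).+1 \in [pchar K] by rewrite -pE.
have -> : (4 * k = 2 * (2 * k))%N by rewrite mulnA.
rewrite (central_binomial_pchar pK' kn).
rewrite exprM mulrAC mulrC -mulrA -exprMn; congr (_ * _ ^+ _).
rewrite sqrrN natrM rmorphXn /=.
have h16 : 16%:R = 4%:R ^+ 2 :> K by rewrite -natrX.
have h4 : 4%:R ^+ 2 != 0 :> K by rewrite (natrM K 2 2) !mulf_neq0.
rewrite h16 invfM; transitivity (4%:R ^+ 2 / 4%:R ^+ 2 * (b%:~R * (b%:~R / q%:R)) : K).
  by ring.
by rewrite mulfV // mul1r.
Qed.

Notation i4 := (sqrtN1 q a b).
Notation A := (jacobi_re 'F_q e).
Notation B := (jacobi_im i4 e).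

(** A root of unity of order 4q yields both ingredients: this one of order four for the quartic
    character, and [z ^+ 4] of order q for the additive character. *)
Let j := z ^+ q.

Let j2 : j ^+ 2 = -1.
Proof.
have jprim : 4.-primitive_root j.
  by have := dvdn_prim_root zq (dvdn_mulr q (dvdnn 4)); rewrite mulKn.
have /eqP : (j ^+ 2 - 1) * (j ^+ 2 + 1) = 0.
  by rewrite -subr_sqr -exprM (prim_expr_order jprim) expr1n subrr.
by rewrite mulf_eq0 subr_eq0 -(prim_order_dvd jprim) addr_eq0 => /eqP.
Qed.

Lemma sunsum_qchar_identity :
  ((-1) ^+ (n * e) * in_alg K (sunsum p q b) * 2%:R) *
    (qchar i4 e j p%:R ^+ 2 * A%:~R) =
  qchar i4 e (- j) p%:R * (A%:~R + j * B%:~R) +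
  qchar i4 e j p%:R * (A%:~R - j * B%:~R).
Proof.
have iota2 := sqrtN1_sq q_pr qab; have N1 := FqN1 q_pr qE.
have cF := cardFq q_pr qE.
have q0 := prime_gt0 q_pr.
have wprim : q.-primitive_root (z ^+ 4).
  by have := dvdn_prim_root zq (dvdn_mull 4 (dvdnn q)); rewrite mulnK.
have psiD := add_charD q_pr wprim.
have psi0 : add_char (z ^+ 4) (0 : 'F_q) = 1 := expr0 _.
have psi1 := add_char1 q_pr wprim.
have pFq : p%:R != 0 :> 'F_q.
  rewrite -(dvdn_pcharf (pchar_Fp q_pr)).
  by apply: contra pq; rewrite !dvdn_prime2 // eq_sym.
have Ep (x : K) : x ^+ p = x * (x ^+ 2) ^+ n by rewrite -exprM -exprS -pE.
have jp : j ^+ p = j \/ j ^+ p = - j.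
  rewrite Ep j2 -signr_odd mulrC.
  by case: (odd n); [right; rewrite mulN1r | left; rewrite mul1r].
have Q0 : q%:R != 0 :> K by rewrite -(dvdn_pcharf pK).
have gQ := gauss_qchar2_sq iota2 N1 cF j2 two_neq0 psiD psi0 psi1.
have Qcard : #|'F_q|%:R = q%:R :> K by rewrite card_Fp.
(* The sum over even indices involves only the square of B / g, so the sign of B is immaterial. *)
have B2 : B ^+ 2 = b ^+ 2.
  apply: (addrI (A ^+ 2)); rewrite (jacobi_norm_int q_pr qE qab).
  by rewrite (jacobi_re_sq q_pr qE qab a_odd).
have sqs : ((-1) ^+ e) ^+ 2 = 1 :> K by rewrite sqrr_sign.
have key := @power_sum_of_gauss_relations K n j A%:~R B%:~R ((-1) ^+ e) q%:R
  (gauss (add_char (z ^+ 4)) (qchar i4 e j)) (gauss (add_char (z ^+ 4)) (qchar i4 e (- j)))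
  (gauss (add_char (z ^+ 4)) (qchar2 i4 e j)) (qchar i4 e j p%:R) (qchar i4 e (- j) p%:R).
rewrite -pE -Qcard in key.
rewrite -key //; last first.
- move=> jE; split.
    by rewrite (gauss_qchar_frobenius iota2 N1 cF pK pFq psiD psi0 j2 jp) jE opprK.
  have NjE : (- j) ^+ p = j by rewrite Ep sqrrN mulNr -Ep jE ?opprK.
  by rewrite (gauss_qchar_frobenius iota2 N1 cF pK pFq psiD psi0 j2) NjE //; left.
- move=> jE; split.
    by rewrite (gauss_qchar_frobenius iota2 N1 cF pK pFq psiD psi0 j2 jp) jE.
  have NjE : (- j) ^+ p = - j by rewrite Ep sqrrN mulNr -Ep jE ?opprK.
  by rewrite (gauss_qchar_frobenius iota2 N1 cF pK pFq psiD psi0 j2) NjE ?opprK //; right.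
- exact: (gauss_qchar2_frobenius iota2 N1 cF pK pFq psiD psi0 j2 jp).
- exact: (gauss_qchar_conj iota2 N1 cF j2 two_neq0 psiD psi0 psi1).
- exact: (gauss_qcharN_sq iota2 N1 cF j2 two_neq0 psiD).
- exact: (gauss_qchar_sq iota2 N1 cF j2 two_neq0 psiD).
- by rewrite Qcard.
congr (_ * _); rewrite sum_even_binomial expr_div_n gQ Qcard.
rewrite -rmorphXn B2 rmorphXn /= -in_alg_sunsum exprAC -exprM mulnC.
by rewrite -mulrA [_ * 2%:R]mulrC.
Qed.

(** A is a up to sign, hence nonzero modulo p, and the proportionality of (A, B) to (a, b) removes
    the sign from the ratio. *)
Lemma jacobi_ratio : A%:~R != 0 :> K /\ B%:~R / A%:~R = in_alg K (b%:~R / a%:~R).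
Proof.
have aK : a%:~R != 0 :> K by rewrite -(dvdz_pcharf pK).
have AK : A%:~R != 0 :> K.
  rewrite -sqrf_eq0 -rmorphXn (jacobi_re_sq q_pr qE qab a_odd) rmorphXn /=.
  by rewrite sqrf_eq0.
split=> //; rewrite fmorph_div !rmorph_int; apply/eqP.
rewrite eqr_div // -!rmorphM /= mulrC (jacobi_proportional q_pr qE qab a_odd).
exact: eqxx.
Qed.

(** With B = r A the identity can be divided by 2 A. When chi(p) is 1 or -1 the terms in B cancel,
    and when it is j or -j the terms in A cancel, leaving a multiple of r. *)
Lemma sunsum_value :
  let L : 'F_p := (-1) ^+ (n * e) * sunsum p q b in
  let r : 'F_p := b%:~R / a%:~R in
  [/\ p%:R ^+ e = 1 :> 'F_q -> L = 1, p%:R ^+ e = -1 :> 'F_q -> L = -1,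
      p%:R ^+ e = i4 -> L = - r & p%:R ^+ e = - i4 -> L = r].
Proof.
move=> L r; have iota2 := sqrtN1_sq q_pr qab; have N1 := FqN1 q_pr qE.
have Nj2 : (- j) ^+ 2 = -1 by rewrite sqrrN.
have [A0 BA] := jacobi_ratio; have BE : B%:~R = in_alg K r * A%:~R by rewrite -BA divfK.
have LE : in_alg K L = (-1) ^+ (n * e) * in_alg K (sunsum p q b).
  by rewrite rmorphM rmorph_sign.
have A2 : 2%:R * A%:~R != 0 :> K by rewrite mulf_neq0.
have L_eq (c : 'F_p) : in_alg K L * 2%:R * A%:~R = in_alg K c * (2%:R * A%:~R) -> L = c.
  by rewrite -mulrA => /(mulIf A2)/fmorph_inj.
have := sunsum_qchar_identity; rewrite /qchar -LE BE => h.
have v1 := qval1 iota2 N1; have vi := qvali iota2 N1.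
split=> pe; apply: L_eq; move: h; rewrite pe ?qvalN ?v1 ?vi // => h.
- by rewrite rmorph1; move: h; rewrite expr1n !mul1r => ->; ring.
- by rewrite rmorphN rmorph1; move: h; rewrite sqrrN expr1n !mul1r => ->; ring.
- rewrite rmorphN; move: h; rewrite j2 => h.
  transitivity (- (- j * (A%:~R + j * (in_alg K r * A%:~R)) +
                   j * (A%:~R - j * (in_alg K r * A%:~R)))).
    by rewrite -h; ring.
  transitivity (j ^+ 2 * 2%:R * in_alg K r * A%:~R); first by ring.
  by rewrite j2; ring.
- move: h; rewrite sqrrN j2 opprK => h.
  transitivity (- (j * (A%:~R + j * (in_alg K r * A%:~R)) +
                   - j * (A%:~R - j * (in_alg K r * A%:~R)))).
    by rewrite -h; ring.
  transitivity (- j ^+ 2 * 2%:R * in_alg K r * A%:~R); first by ring.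
  by rewrite j2; ring.
Qed.
End CharacteristicP.

Theorem theorem2p3 (q p : nat) (a b : int) :
  prime q -> q %% 4 = 1 -> Posz q = (a ^+ 2 + b ^+ 2)%R -> odd (absz a) ->
  prime p -> odd p -> ~~ (Posz p %| (a * Posz q)%R)%Z ->
  let e := (q - 1) %/ 4 in
  let L : 'F_p := ((-1) ^+ ((p - 1) %/ 2 * e) * sunsum p q b)%R in
  let r : 'F_p := (b%:~R / a%:~R)%R in
  [/\ p ^ e = 1 %[mod q] -> L = 1%R,
      (Posz (p ^ e) = (- 1)%R %[mod Posz q])%Z -> L = (- 1)%R,
      ((a * Posz (p ^ e))%R = b %[mod Posz q])%Z -> L = (- r)%R
    & ((a * Posz (p ^ e))%R = (- b)%R %[mod Posz q])%Z -> L = r].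
Proof.
move=> q_pr q4 qab a_odd p_pr p_odd paq e L r.
have qE : q = (4 * e).+1 by rewrite /e; lia.
have pE : p = (2 * ((p - 1) %/ 2)).+1 by lia.
have [pa pq] : ~~ (p %| a)%Z /\ ~~ (p %| q).
  by split; apply: contra paq => h; [apply: dvdz_mulr | apply: dvdz_mull].
have p4q : ~~ (p %| 4 * q).
  rewrite Euclid_dvdM // negb_or pq andbT -[4]/(2 ^ 2) Euclid_dvdX // andbT.
  by rewrite dvdn_prime2 //; apply: contraTneq p_odd => ->.
have q0 := prime_gt0 q_pr.
have [K [z zq]] : exists (K : fieldExtType 'F_p) (z : K), ((4 * q).-primitive_root z)%R.
  by apply: exists_prim_root_pchar; rewrite ?muln_gt0.
have [h1 hN1 hi hNi] := sunsum_value q_pr qE qab a_odd p_pr pE pa pq zq.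
(* Integer congruences modulo q become equalities in the prime field; there a can be inverted, which
   recovers the residue b/a. *)
have modq (s t : int) : (s = t %[mod q])%Z -> (s%:~R = t%:~R :> 'F_q)%R.
  move=> /eqP; rewrite eqz_mod_dvd (dvdz_pcharf (pchar_Fp q_pr)) rmorphB subr_eq0.
  by move/eqP.
have peE : ((p ^ e)%N%:~R = p%:R ^+ e :> 'F_q)%R by rewrite -natrX.
have aFq := aF q_pr qab.
split=> h.
- by apply: h1; rewrite -peE; apply: (modq _ 1%R); rewrite !modz_nat h.
- by apply: hN1; rewrite -peE (modq _ _ h) rmorphN.
- apply: hi; rewrite /sqrtN1; apply: (canRL (mulfK aFq)).
  by rewrite mulrC -peE -rmorphM /= (modq _ _ h).
- apply: hNi; rewrite /sqrtN1 -mulNr; apply: (canRL (mulfK aFq)).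
  by rewrite mulrC -peE -rmorphM /= (modq _ _ h) rmorphN.
Qed.
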